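(* Let $X$ and $Y$ be infinite-dimensional real Banach spaces with property (P1). Then $X\oplus_1 Y$ has property (P2).
   Context: $X\oplus_1 Y$ denotes the direct sum $X\oplus Y$ equipped with the norm $\|(x,y)\|=\|x\|+\|y\|$. For a Banach space $Z$ with closed unit ball $B_Z$, dual $Z^\ast$ and dual unit sphere $S_{Z^\ast}$, a slice of $B_Z$ is a set of the form $S(z^\ast,\alpha)=\{z\in B_Z\colon z^\ast(z)>1-\alpha\}$ with $z^\ast\in S_{Z^\ast}$ and $\alpha>0$. A convex combination of slices of $B_Z$ is a set of the form $\sum_{i=1}^n\lambda_iS_i=\{\sum_{i=1}^n\lambda_i s_i\colon s_i\in S_i\}$, where $n\in\mathbb{N}$, $\lambda_1,\dotsc,\lambda_n\geq 0$, $\sum_{i=1}^n\lambda_i=1$, and $S_1,\dotsc,S_n$ are slices of $B_Z$. Property (P1) of $Z$: every convex combination of slices of $B_Z$ is open in the relative weak topology of $B_Z$. Property (P2) of $Z$: every convex combination of slices of $B_Z$ has nonempty interior in the relative weak topology of $B_Z$. *)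

(* Defs.v *)
From HB Require Import structures.
From mathcomp Require Import all_boot all_order all_algebra.
From mathcomp Require Import all_classical all_reals all_analysis.

Set Implicit Arguments.
Unset Strict Implicit.
Unset Printing Implicit Defensive.

Import Order.TTheory GRing.Theory Num.Theory.
Import numFieldNormedType.Exports.

Local Open Scope classical_set_scope.
Local Open Scope ring_scope.

(* An alias of X * Y: the product type itself carries the max norm. *)
Definition l1sum (R : realType) (X Y : normedModType R) : Type := (X * Y)%type.

Section L1sum.
Context {R : realType}.

Section normed.
Context {X Y : normedModType R}.
Local Notation Z := (l1sum X Y).

HB.instance Definition _ := GRing.Lmodule.copy Z (X * Y)%type.

Definition l1norm (z : Z) : R := `|z.1| + `|z.2|.

Lemma l1norm_triangle (z t : Z) : l1norm (z + t) <= l1norm z + l1norm t.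
Proof. by rewrite /l1norm addrACA lerD // ler_normD. Qed.

Lemma l1normZ (a : R) (z : Z) : l1norm (a *: z) = `|a| * l1norm z.
Proof. by rewrite /l1norm !normrZ mulrDr. Qed.

Lemma l1norm0_eq0 (z : Z) : l1norm z = 0 -> z = 0.
Proof.
case: z => x y /eqP; rewrite /l1norm paddr_eq0 //= !normr_eq0.
by case/andP => /eqP -> /eqP ->.
Qed.

HB.instance Definition _ :=
  Lmodule_isNormed.Build R Z l1norm_triangle l1normZ l1norm0_eq0.

Lemma l1sum_normE (z : Z) : `|z| = `|z.1| + `|z.2|.
Proof. by []. Qed.

End normed.

Section complete.
Context {X Y : completeNormedModType R}.
Local Notation Z := (l1sum X Y).

Lemma l1sum_complete (F : set_system Z) : ProperFilter F -> cauchy F -> cvg F.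
Proof.
move=> FF /cauchy_ballP Fc.
have c1 : cauchy ((fun z : Z => z.1) @ F).
  apply/cauchy_ballP => e e0; rewrite near_map2.
  apply: filterS (Fc e e0) => -[z t] /=; rewrite -!ball_normE /= => zt.
  by apply: le_lt_trans zt; rewrite l1sum_normE /= lerDl.
have c2 : cauchy ((fun z : Z => z.2) @ F).
  apply/cauchy_ballP => e e0; rewrite near_map2.
  apply: filterS (Fc e e0) => -[z t] /=; rewrite -!ball_normE /= => zt.
  by apply: le_lt_trans zt; rewrite l1sum_normE /= lerDr.
have /cvg_ex[x Fx] : cvg ((fun z : Z => z.1) @ F) by exact: cauchy_cvg c1.
have /cvg_ex[y Fy] : cvg ((fun z : Z => z.2) @ F) by exact: cauchy_cvg c2.
apply/cvg_ex; exists ((x, y) : Z).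
apply/cvgrPdist_lt => e e0; have e20 : 0 < e / 2 by rewrite divr_gt0.
move/cvgrPdist_lt : Fx => /(_ _ e20) Fx.
move/cvgrPdist_lt : Fy => /(_ _ e20) Fy.
near=> z; rewrite l1sum_normE /= [e]splitr ltrD //.
- by near: z; exact: Fx.
- by near: z; exact: Fy.
Unshelve. all: by end_near. Qed.

HB.instance Definition _ := Uniform_isComplete.Build Z l1sum_complete.

End complete.
End L1sum.

Section BanachSpace.
Context {R : realType} (Z : completeNormedModType R).

Definition finite_dimensional : Prop :=
  exists (n : nat) (e : 'I_n -> Z),
    forall z : Z, exists c : 'I_n -> R, z = \sum_(i < n) c i *: e i.

Definition infinite_dimensional : Prop := ~ finite_dimensional.

Definition unit_ball : set Z := [set z | `|z| <= 1].

Definition dual : Type := {f : {linear Z -> R} | continuous f}.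

Definition dual_fun (f : dual) : Z -> R := sval f.

Definition dual_norm (f : dual) : R :=
  sup [set `|dual_fun f z| | z in unit_ball].

Definition dual_sphere : set dual := [set f | dual_norm f = 1].

(* The coarsest topology making every continuous functional continuous. *)
Definition weak_space : Type :=
  sup_topology (fun f : dual =>
    Topological.on (initial_topology (dual_fun f))).

HB.instance Definition _ := Topological.on weak_space.

Definition weak_ball : Type := subspace (unit_ball : set weak_space).

HB.instance Definition _ := Topological.on weak_ball.

Definition slice (f : dual) (alpha : R) : set Z :=
  [set z | unit_ball z /\ dual_fun f z > 1 - alpha].

Definition is_slice (S : set Z) : Prop :=
  exists f alpha, [/\ dual_sphere f, 0 < alpha & S = slice f alpha].

Definition convex_combination (n : nat) (lambda : 'I_n -> R)
    (S : 'I_n -> set Z) : set Z :=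
  [set \sum_(i < n) lambda i *: s i | s in [set s | forall i, S i (s i)]].

Definition is_convex_combination_of_slices (C : set Z) : Prop :=
  exists (n : nat) (lambda : 'I_n -> R) (S : 'I_n -> set Z),
    [/\ forall i, 0 <= lambda i,
        \sum_(i < n) lambda i = 1,
        forall i, is_slice (S i) &
        C = convex_combination lambda S].

(* In P1 and P2, C is contained in unit_ball, so that the isolated points
   which [subspace] adds outside unit_ball play no role. *)
Definition P1 : Prop :=
  forall C : set Z, is_convex_combination_of_slices C ->
    open (C : set weak_ball).

Definition P2 : Prop :=
  forall C : set Z, is_convex_combination_of_slices C ->
    interior (C : set weak_ball) !=set0.

End BanachSpace.

Arguments unit_ball {R} Z _.

(* Main.v *)
(* A functional of norm one on the l1-sum has norm one on X or on Y; split the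
   slices accordingly into two groups of total weights mu and nu. By (P1) and
   infinite dimension, the normalized combination of the X-group contains the
   relatively weakly open neighbourhood of a unit vector a; similarly b in Y.
   Claim: (mu a, nu b) is interior. The norm is weakly lower semicontinuous
   (Hahn-Banach), so a nearby (u, v) in the ball has norms close to mu and nu,
   say |u| <= p, |v| <= q with p + q = 1. Up to scaling, u and v are then
   combinations of their own groups, and if p > mu the surplus p - mu is carried
   by small X-components of the elements of the Y-group, which stay in their
   slices because the combination was taken in slices of half the depth. *)
From HB Require Import structures.
Require Import Defs.
From mathcomp Require Import all_boot all_order all_algebra.
From mathcomp Require Import all_classical all_reals all_analysis.
From mathcomp Require Import ring lra.

Set Implicit Arguments.
Unset Strict Implicit.
Unset Printing Implicit Defensive.

Import Order.TTheory GRing.Theory Num.Theory.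
Import numFieldNormedType.Exports.

Local Open Scope classical_set_scope.
Local Open Scope ring_scope.

(** * Sublinear functionals and their minimal elements *)

Section Sublinear.
Context {R : realType} {V : lmodType R}.
Implicit Types (q : V -> R) (x y : V).

Definition sublinear q :=
  (forall x y, q (x + y) <= q x + q y) /\
  (forall c x, 0 < c -> q (c *: x) <= c * q x).

Lemma sublinear0 q : sublinear q -> q 0 = 0.
Proof.
move=> [qD qZ]; have := qD 0 0; have := qZ 2^-1 0.
by rewrite addr0 scaler0 invr_gt0 => /(_ (ltr0n _ _)); lra.
Qed.

Lemma sublinearN q x : sublinear q -> - q (- x) <= q x.
Proof.
by move=> sq; have := sq.1 x (- x); rewrite subrr sublinear0 //; lra.
Qed.

Lemma sublinearZ q c x : sublinear q -> 0 <= c -> q (c *: x) = c * q x.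
Proof.
move=> sq; rewrite le_eqVlt => /predU1P[<-|c0].
  by rewrite scale0r mul0r sublinear0.
apply/eqP; rewrite eq_le sq.2 //= mulrC -ler_pdivlMr // mulrC.
have := sq.2 c^-1 (c *: x); rewrite scalerA mulVf ?gt_eqF // scale1r.
by apply; rewrite invr_gt0.
Qed.

Definition shift_values q y x : set R :=
  [set q (x + t *: y) - t * q y | t in [set t : R | 0 <= t]].

(* The minorant of [q] obtained by forcing the value [- q y] at [- y]. *)
Definition shift_inf q y x : R := inf (shift_values q y x).

Lemma shift_inf_le q y x t : sublinear q -> 0 <= t ->
  shift_inf q y x <= q (x + t *: y) - t * q y.
Proof.
move=> sq t0; apply: ge_inf; last by exists t.
(* The infimum is over a set bounded below: write [s *: y] as [(x + s *: y) - x] and use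
   subadditivity. *)
exists (- q (- x)) => _ [s /= s0 <-].
have := sq.1 (x + s *: y) (- x).
by rewrite addrAC subrr add0r sublinearZ //; lra.
Qed.

Lemma shift_infP q y x r :
  (forall t, 0 <= t -> r <= q (x + t *: y) - t * q y) -> r <= shift_inf q y x.
Proof.
move=> rq; apply: lb_le_inf; first by exists (q (x + 0 *: y) - 0 * q y), 0 => /=.
by move=> _ [t t0 <-]; exact: rq.
Qed.

(** Parameters [t] and [s] tested for two vectors add up to an admissible parameter for their sum,
    and parameters scale along with the vector. *)
Lemma shift_inf_sublinear q y : sublinear q -> sublinear (shift_inf q y).
Proof.
move=> sq; split => [x x'|c x c0].
  rewrite -lerBlDr; apply: shift_infP => t t0.
  rewrite lerBlDl -lerBlDr; apply: shift_infP => s s0.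
  have := shift_inf_le y (x + x') sq (addr_ge0 s0 t0).
  have := sq.1 (x + t *: y) (x' + s *: y).
  by rewrite addrACA -scalerDl (addrC t s) mulrDl; lra.
rewrite mulrC -ler_pdivrMr //; apply: shift_infP => t t0.
rewrite ler_pdivrMr //.
have := shift_inf_le y (c *: x) sq (mulr_ge0 (ltW c0) t0).
have := sublinearZ (x + t *: y) sq (ltW c0).
by rewrite scalerDr scalerA => ->; lra.
Qed.

Lemma shift_inf_le_id q y x : sublinear q -> shift_inf q y x <= q x.
Proof.
by move=> sq; have := shift_inf_le y x sq (lexx 0); rewrite scale0r addr0 mul0r subr0.
Qed.

Lemma shift_infN q y : sublinear q -> shift_inf q y (- y) <= - q y.
Proof.
move=> sq; have := shift_inf_le y (- y) sq ler01.
by rewrite scale1r addNr sublinear0 // mul1r sub0r.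
Qed.

Definition minimal_sublinear q := sublinear q /\
  forall r, sublinear r -> (forall x, r x <= q x) -> r = q.

(** Minimality forces [shift_inf q y = q] for every [y]. The bound at [- y] then makes [q] odd, and
    the parameter 1 gives superadditivity. *)
Lemma minimal_sublinear_linear q : minimal_sublinear q ->
  (forall x y, q (x + y) = q x + q y) /\ (forall c x, q (c *: x) = c * q x).
Proof.
move=> [sq minq].
have shiftE y : shift_inf q y = q.
  by apply: minq; [exact: shift_inf_sublinear|move=> x; exact: shift_inf_le_id].
have qN x : q (- x) = - q x.
  apply/eqP; rewrite eq_le -{1}(shiftE x) shift_infN //=.
  by have := sublinearN x sq; lra.
split=> [x y|c x].
  apply/eqP; rewrite eq_le sq.1 /=.
  have := shift_inf_le y x sq ler01.
  by rewrite shiftE scale1r mul1r; lra.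
have [c0|c0] := leP 0 c; first exact: sublinearZ.
by rewrite -[c]opprK scaleNr qN sublinearZ ?mulNr // oppr_ge0 ltW.
Qed.

Lemma chain_inf_sublinear (A : set (V -> R)) :
  A !=set0 -> (forall r, A r -> sublinear r) ->
  total_on A (fun r s => forall x, r x <= s x) ->
  sublinear (fun x => inf [set r x | r in A]) /\
  (forall r, A r -> forall x, inf [set r x | r in A] <= r x).
Proof.
move=> [r0 Ar0] sA totA.
have lb r x : A r -> inf [set r x | r in A] <= r x.
  move=> Ar; apply: ge_inf; last by exists r.
  (* Any [s] in the chain is comparable with [r0], and either way [- r0 (- x)] stays below [s x]. *)
  exists (- r0 (- x)) => _ [s As <-].
  have [r0s|sr0] := totA _ _ Ar0 As.
    exact: le_trans (sublinearN _ (sA _ Ar0)) (r0s _).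
  by apply: le_trans (sublinearN _ (sA _ As)); rewrite lerN2.
have glb x m : (forall r, A r -> m <= r x) -> m <= inf [set r x | r in A].
  move=> mA; apply: lb_le_inf; first by exists (r0 x), r0.
  by move=> _ [r Ar <-]; exact: mA.
split; last by move=> r Ar x; exact: lb.
split=> [x y|c x c0].
  rewrite -lerBlDr; apply: (glb) => r Ar; rewrite lerBlDl -lerBlDr.
  apply: (glb) => s As; rewrite lerBlDl addrC.
  (* The smaller of [r] and [s] serves for both summands: its value at [x + y] is at most
     [r x + s y]. *)
  have [rs|sr] := totA _ _ Ar As.
    apply: le_trans (lb _ _ Ar) _; apply: le_trans ((sA _ Ar).1 _ _) _.
    by rewrite addrC lerD.
  apply: le_trans (lb _ _ As) _; apply: le_trans ((sA _ As).1 _ _) _.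
  by rewrite addrC lerD.
rewrite mulrC -ler_pdivrMr //; apply: glb => r Ar; rewrite ler_pdivrMr // mulrC.
by apply: le_trans (lb _ _ Ar) _; exact: (sA _ Ar).2.
Qed.

Lemma exists_minimal_sublinear q : sublinear q ->
  exists2 r, minimal_sublinear r & forall x, r x <= q x.
Proof.
move=> sq; pose T := {r | sublinear r /\ forall x, r x <= q x}.
(* The order is reversed, so that a maximal element in the sense of Zorn is a minimal functional. *)
pose below (r s : T) := `[< forall x, sval s x <= sval r x >].
have [//|||A totA|[r [sr rq]] rmin] := @Zorn T below.
- by move=> r; exact/asboolP.
- move=> r s t /asboolP sr /asboolP ts; apply/asboolP => x.
  exact: le_trans (ts x) (sr x).
- move=> [r pr] [s ps] /asboolP/= sr /asboolP/= rs; apply: eq_exist.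
  by apply/funext => x; apply/eqP; rewrite eq_le rs sr.
- have [->|/set0P[a0 Aa0]] := eqVneq A set0.
    by exists (exist _ q (conj sq (fun=> lexx _))) => s [].
  pose B := [set sval r | r in A].
  have [||r s|sB Ble] := @chain_inf_sublinear B.
  + by exists (sval a0), a0.
  + by move=> _ [[r [sr rq]] _ <-].
  + move=> [r' Ar <-] [s' As <-].
    by case: (totA _ _ Ar As) => /asboolP; [right|left].
  have Bq x : inf [set r x | r in B] <= q x.
    apply: le_trans ((svalP a0).2 x); by apply: Ble; exists a0.
  pose b : T := exist _ (fun x => inf [set r x | r in B]) (conj sB Bq).
  exists b => s As; apply/asboolP => x /=.
  by apply: Ble; exists s.
exists r => //; split=> // s ss sr'.
have sq' x : s x <= q x by exact: le_trans (sr' x) (rq x).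
have /(congr1 sval) := rmin (exist _ s (conj ss sq')) (asboolT sr').
by [].
Qed.
End Sublinear.

(** * Norming functionals *)

Section HahnBanach.
Context {R : realType} {V : normedModType R}.

Lemma sublinear_norm : sublinear (fun x : V => `|x|).
Proof.
by split=> [x y|c x c0]; [exact: ler_normD|rewrite normrZ gtr0_norm].
Qed.

(** A minimal functional below the norm shifted at [a] is linear and dominated by the norm. The
    shift gives it a value at most [- |a|] at [- a], which forces the value [|a|] at [a]. *)
Lemma norming_functional (a : V) : exists f : {linear V -> R},
  (forall x, `|f x| <= `|x|) /\ f a = `|a|.
Proof.
have sn := sublinear_norm.
have [f minf fle] := exists_minimal_sublinear (shift_inf_sublinear a sn).
have [fD fZ] := minimal_sublinear_linear minf.
have fN x : f (- x) = - f x by rewrite -scaleN1r fZ mulN1r.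
have fn x : f x <= `|x| by exact: le_trans (fle x) (shift_inf_le_id _ _ sn).
have fab x : `|f x| <= `|x|.
  by rewrite ler_norml fn andbT lerNl -fN -[`|x|]normrN fn.
have lf : linear f by move=> c x y; rewrite fD fZ.
pose fL : {linear V -> R} := HB.pack f (GRing.isLinear.Build R V R _ f lf).
exists fL; split=> //.
apply/eqP; rewrite eq_le fn /=.
by have := le_trans (fle (- a)) (shift_infN a sn); rewrite fN lerN2.
Qed.

End HahnBanach.

(** * Slices, weak neighbourhoods and infinite dimension *)

Section Dual.
Context {R : realType} {Z : completeNormedModType R}.
Implicit Types (f : dual Z) (a x z : Z).

Lemma dual_funD f x z : dual_fun f (x + z) = dual_fun f x + dual_fun f z.
Proof. exact: linearD. Qed.

Lemma dual_funN f z : dual_fun f (- z) = - dual_fun f z.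
Proof. exact: linearN. Qed.

Lemma dual_funZ f c z : dual_fun f (c *: z) = c * dual_fun f z.
Proof. exact: linearZ. Qed.

Lemma dual_fun_le_norm f z : `|z| <= 1 -> `|dual_fun f z| <= dual_norm f.
Proof.
move=> z1; apply: ub_le_sup; last by exists z.
have /linear_boundedP/pinfty_ex_gt0[r r0 fr] :=
  @continuous_linear_bounded R Z R 0 (sval f) (svalP f 0).
exists r => _ [x x1 <-]; apply: le_trans (fr x) _.
by rewrite ler_piMr // ltW.
Qed.

Lemma dual_norm_ge0 f : 0 <= dual_norm f.
Proof. by apply: le_trans (@dual_fun_le_norm f 0 _); rewrite ?normr0. Qed.

Lemma dual_fun_le f z : `|dual_fun f z| <= dual_norm f * `|z|.
Proof.
have [->|z0] := eqVneq z 0; first by rewrite /dual_fun linear0 !normr0 mulr0.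
have nz0 : 0 < `|z| by rewrite normr_gt0.
have : `|dual_fun f (`|z|^-1 *: z)| <= dual_norm f.
  by apply: dual_fun_le_norm; rewrite normrZ normfV normr_id mulVf ?gt_eqF.
by rewrite dual_funZ normrM normfV normr_id ler_pdivrMl // mulrC.
Qed.

Lemma dual_norm_le f c : (forall z, `|z| <= 1 -> `|dual_fun f z| <= c) ->
  dual_norm f <= c.
Proof.
move=> fc; apply: ge_sup; last by move=> _ [z z1 <-]; exact: fc.
by exists `|dual_fun f 0|, 0 => //; rewrite /unit_ball /= normr0.
Qed.

(** If the slice were empty, the symmetry of the ball would bound the absolute value of [f] by
    [1 - alpha] there. *)
Lemma slice_nonempty f alpha : dual_sphere f -> 0 < alpha -> slice f alpha !=set0.
Proof.
move=> f1 alpha0; apply: contrapT => /forallNP S0.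
have fle z : `|z| <= 1 -> dual_fun f z <= 1 - alpha.
  by move=> z1; rewrite leNgt; apply/negP => fz; apply: (S0 z).
have : dual_norm f <= 1 - alpha.
  apply: dual_norm_le => z z1; rewrite ler_norml fle // andbT lerNl.
  by rewrite -dual_funN fle // normrN.
by rewrite f1; lra.
Qed.

Lemma bounded_linear_dual (f : {linear Z -> R}) (c : R) :
  (forall z, `|f z| <= c * `|z|) -> exists g : dual Z, dual_fun g = f.
Proof.
move=> fc; suff cf : continuous f by exists (exist _ f cf).
apply: bounded_linear_continuous; apply/linear_boundedP.
near=> r => z; apply: le_trans (fc z) _; by rewrite ler_wpM2r.
Unshelve. all: by end_near. Qed.

(** An explicit form of the neighbourhood filter of [weak_space] at [a], as [weak_nbhs_base] and
    [weak_base_nbhs] show together. *)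
Definition weak_base a : set_system Z := [set V |
  exists (I : finType) (F : I -> dual Z) (e : R), 0 < e /\
  forall z, (forall i, `|dual_fun (F i) z - dual_fun (F i) a| < e) -> V z].

#[local] Instance weak_base_filter a : Filter (weak_base a).
Proof.
split.
- by exists void, (fun i : void => match i with end), 1.
- move=> U V [I [F [e [e0 FU]]]] [J [G [d [d0 GV]]]].
  exists (I + J)%type, (fun k => match k with inl i => F i | inr j => G j end).
  exists (Num.min e d); split=> [|z zFG]; first by rewrite lt_min e0.
  split; [apply: FU => i; have := zFG (inl i)|apply: GV => j; have := zFG (inr j)].
    by rewrite lt_min => /andP[].
  by rewrite lt_min => /andP[].
- move=> U V UV [I [F [e [e0 FU]]]]; exists I, F, e; split=> // z /FU; exact: UV.
Qed.

Lemma weak_nbhs_base a (V : set Z) : nbhs (a : weak_space Z) V -> weak_base a V.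
Proof.
suff : weak_base a --> (a : weak_space Z) by apply.
(* Convergence in a supremum topology is tested on one functional at a time, so a single strip
   suffices. *)
apply/cvg_sup => f {}V.
rewrite nbhsE => -[_ [[B oB <-] /= Ba] sBV].
have /nbhs_ballP[e /= e0 eB] : nbhs (dual_fun f a) B by exact: open_nbhs_nbhs.
exists unit, (fun=> f), e; split=> // z /(_ tt) ze; apply/sBV/eB.
by rewrite /ball /= distrC.
Qed.

Lemma dual_fun_weak_continuous f : continuous (dual_fun f : weak_space Z -> R).
Proof.
move=> a; apply: cvg_trans; last first.
  exact: (@initial_continuous _ _ (dual_fun f) a).
apply: cvg_app.
by move: (@cvg_refl _ (nbhs (a : weak_space Z))) => /cvg_sup /(_ f).
Qed.

Lemma weak_base_nbhs a (V : set Z) : weak_base a V -> nbhs (a : weak_space Z) V.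
Proof.
move=> [I [F [e [e0 FV]]]].
have near_strip i : nbhs (a : weak_space Z)
    [set z | `|dual_fun (F i) z - dual_fun (F i) a| < e].
  have /cvgrPdist_lt /(_ _ e0) := @dual_fun_weak_continuous (F i) a.
  by apply: filterS => z; rewrite distrC.
by apply: filterS FV _; exact: filter_forall near_strip.
Qed.

Lemma open_weak_ball_base (C : set Z) a : open (C : set (weak_ball Z)) ->
  C a -> `|a| <= 1 -> weak_base a [set z | `|z| <= 1 -> C z].
Proof.
move=> oC Ca a1; apply: weak_nbhs_base.
have : nbhs (a : weak_ball Z) C by exact: open_nbhs_nbhs.
by case: (@nbhs_subspaceP _ (unit_ball Z : set (weak_space Z)) a).
Qed.

Lemma weak_ball_interior_base (C : set Z) a : `|a| <= 1 ->
  weak_base a [set z | `|z| <= 1 -> C z] ->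
  interior (C : set (weak_ball Z)) a.
Proof.
move=> a1 /weak_base_nbhs aC.
rewrite /interior /=.
by case: (@nbhs_subspaceP _ (unit_ball Z : set (weak_space Z)) a).
Qed.

(** Induction on the list. If some [w] is killed by the old functionals but not by the new one, [w]
    joins the vectors and corrects the new value; otherwise the old remainder is already killed by
    the new functional. *)
Lemma finite_codimension (I : eqType) (F : I -> dual Z) (r : seq I) :
  exists n (e : 'I_n -> Z), forall z, exists c : 'I_n -> R,
    {in r, forall i, dual_fun (F i) (z - \sum_(j < n) c j *: e j) = 0}.
Proof.
elim: r => [|i0 r [n [e eP]]].
  by exists 0%N, (fun=> 0) => z; exists (fun=> 0).
have [[w [w0 wr]]|noW] := pselect (exists w, dual_fun (F i0) w != 0 /\
    {in r, forall i, dual_fun (F i) w = 0}).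
  exists n.+1, (fun j => if unlift ord0 j is Some k then e k else w) => z.
  have [c cr] := eP z; pose v := z - \sum_(j < n) c j *: e j.
  pose d := dual_fun (F i0) v / dual_fun (F i0) w.
  exists (fun j => if unlift ord0 j is Some k then c k else d) => i.
  have -> : z - \sum_(j < n.+1) (if unlift ord0 j is Some k then c k else d) *:
      (if unlift ord0 j is Some k then e k else w) = v - d *: w.
    rewrite big_ord_recl unlift_none /v opprD addrCA addrC; congr (_ - _ - _).
    by apply: eq_bigr => j _; rewrite liftK.
  rewrite dual_funD dual_funN dual_funZ inE => /predU1P[->|ir].
    by rewrite /d divfK // subrr.
  by rewrite cr // wr // mulr0 subr0.
exists n, e => z; have [c cr] := eP z; exists c => i.
rewrite inE => /predU1P[->|]; last exact: cr.
by apply/eqP/negPn/negP => zi; apply: noW; exists (z - \sum_(j < n) c j *: e j).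
Qed.

(** With a trivial common kernel, the remainders in [finite_codimension] would vanish and finitely
    many vectors would span [Z]. *)
Lemma common_kernel (I : finType) (F : I -> dual Z) : infinite_dimensional Z ->
  exists2 h : Z, h != 0 & forall i, dual_fun (F i) h = 0.
Proof.
move=> infZ; apply: contrapT => noh; apply: infZ.
have [n [e eP]] := finite_codimension F (enum I).
exists n, e => z; have [c cP] := eP z; exists c.
apply/eqP; rewrite -subr_eq0; apply/negPn/negP => v0; apply: noh.
by exists (z - \sum_(j < n) c j *: e j) => // i; apply: cP; rewrite mem_enum.
Qed.

Lemma line_meets_sphere a x : `|a| <= 1 -> x != 0 ->
  exists t : R, `|a + t *: x| = 1.
Proof.
move=> a1 x0; have nx0 : 0 < `|x| by rewrite normr_gt0.
pose g t := `|a + t *: x|.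
(* At this endpoint the reverse triangle inequality gives norm at least [2 - |a|], hence at least 1,
   while at 0 the norm is at most 1. *)
have T0 : 0 <= 2 / `|x| by rewrite divr_ge0.
have [||t _ gt] := @IVT _ g 0 (2 / `|x|) 1 T0.
- apply: continuous_subspaceT => t; apply: cvg_norm.
  by apply: cvgD; [exact: cvg_cst|apply: cvgZr_tmp; exact: cvg_id].
- rewrite /g scale0r addr0 ge_min le_max a1 /=; apply/orP; right.
  have := lerB_normD ((2 / `|x|) *: x) a; rewrite [_ *: x + a]addrC; apply: le_trans.
  by rewrite normrZ ger0_norm // divfK ?gt_eqF //; lra.
by exists t.
Qed.

(** Moving along a common kernel direction of the functionals that define a neighbourhood changes
    none of their values, so the sphere is reached inside [C]. *)
Lemma weakly_open_meets_sphere (C : set Z) c : infinite_dimensional Z ->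
  open (C : set (weak_ball Z)) -> C c -> `|c| <= 1 -> exists2 a, C a & `|a| = 1.
Proof.
move=> infZ oC Cc c1; have [I [F [e [e0 FC]]]] := open_weak_ball_base oC Cc c1.
have [h h0 Fh] := common_kernel F infZ.
have [t t1] := line_meets_sphere c1 h0.
exists (c + t *: h) => //; apply: FC; last by rewrite t1.
by move=> i; rewrite dual_funD dual_funZ Fh mulr0 addr0 subrr normr0.
Qed.

Lemma norming_dual a : exists2 g : dual Z,
  forall x, `|dual_fun g x| <= `|x| & dual_fun g a = `|a|.
Proof.
have [g [gle ga]] := norming_functional a.
have [|g' g'E] := @bounded_linear_dual g 1; first by move=> x; rewrite mul1r.
by exists g'; rewrite g'E.
Qed.

End Dual.

(** * One group of slices in one summand *)

Section SubfamilyCombination.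
Context {R : realType} {X : completeNormedModType R}.
Context (n : nat) (lambda : 'I_n -> R) (f : 'I_n -> dual X) (alpha : 'I_n -> R).
Context (J : pred 'I_n).
Context (lambda_ge0 : forall i, 0 <= lambda i).
Context (f_sphere : forall i, J i -> dual_sphere (f i)).
Context (alpha_gt0 : forall i, 0 < alpha i).

Let mu := \sum_(i < n | J i) lambda i.
Let selection := [set s : 'I_n -> X | forall i, J i -> slice (f i) (alpha i) (s i)].

Lemma subfamily_convex_combination : 0 < mu -> is_convex_combination_of_slices
  [set mu^-1 *: \sum_(i < n | J i) lambda i *: s i | s in selection].
Proof.
move=> mu0; have [i0 Ji0] : exists i, J i.
  apply: contrapT => /forallNP noJ; move: mu0; rewrite /mu big1 ?ltxx // => i Ji.
  by case: (noJ i).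
(* Only on [J] is the functional known to have norm one, so an index outside [J] gets weight 0 and
   borrows the slice of [i0]. *)
pose r i := if J i then i else i0.
have Jr i : J (r i) by rewrite /r; case: ifP.
exists n, (fun i => if J i then mu^-1 * lambda i else 0),
  (fun i => slice (f (r i)) (alpha (r i))); split.
- by move=> i; case: ifP => // _; rewrite mulr_ge0 // invr_ge0 ltW.
- by rewrite -big_mkcond /= -mulr_sumr mulVf // gt_eqF.
- by move=> i; exists (f (r i)), (alpha (r i)); split=> //; exact: f_sphere.
have sumE (s : 'I_n -> X) :
    \sum_(i < n) (if J i then mu^-1 * lambda i else 0) *: s i =
    mu^-1 *: \sum_(i < n | J i) lambda i *: s i.
  rewrite scaler_sumr [RHS]big_mkcond /=; apply: eq_bigr => i _.
  by case: ifP => // _; rewrite ?scalerA ?scale0r.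
apply/seteqP; split=> [_ [s sJ <-]|_ [s sr <-]].
  exists (s \o r); first by move=> i /=; exact: sJ.
  rewrite sumE; congr (_ *: _); apply: eq_bigr => i Ji.
  by rewrite /= /r Ji.
exists s; last by rewrite sumE.
by move=> i Ji; have := sr i; rewrite /r Ji.
Qed.

Lemma selection_nonempty : selection !=set0.
Proof.
have s_ex i : exists x, J i -> slice (f i) (alpha i) x.
  have [Ji|nJ] := boolP (J i); last by exists 0.
  by have [x xS] := slice_nonempty (f_sphere Ji) (alpha_gt0 i); exists x.
by have [s sP] := choice s_ex; exists s.
Qed.

(** By (P1) and infinite dimension the normalized combination is a weak neighbourhood, relative to
    the ball, of a unit vector [a]. A norming functional of [a], added to the family, yields the
    lower bound on [|u|]; the others place [u / p] in the combination. *)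
Lemma selection_near_sphere : infinite_dimensional X -> P1 X ->
  exists (a : X) (I : finType) (F : I -> dual X) (d : R),
  [/\ `|a| = 1, 0 < d,
    forall (u : X) e, 0 < e ->
      (forall k, `|dual_fun (F k) u - mu * dual_fun (F k) a| < e) ->
      mu - e < `|u| &
    forall (u : X) (p : R), `|u| <= p -> `|p - mu| < d ->
      (forall k, `|dual_fun (F k) u - mu * dual_fun (F k) a| < d) ->
      exists2 s, selection s &
        \sum_(i < n | J i) lambda i *: s i = (mu / p) *: u].
Proof.
move=> infX p1X.
have : 0 <= mu by exact: sumr_ge0.
rewrite le_eqVlt => /predU1P[mu0|mu0].
  (* If [mu = 0], all weights on [J] vanish and any unit vector serves; the empty family of
     functionals yields a nonzero vector to start from. *)
  have [x x0 _] := common_kernel (fun i : void => match i with end) infX.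
  have [|t t1] := @line_meets_sphere _ _ 0 x _ x0; first by rewrite normr0.
  exists (0 + t *: x), void, (fun i : void => match i with end), 1; split=> //.
    by move=> u e e0 _; rewrite -mu0 sub0r; apply: lt_le_trans (normr_ge0 u); rewrite oppr_lt0.
  move=> u p _ _ _; have [s sP] := selection_nonempty.
  exists s => //; rewrite -mu0 mul0r scale0r big1 // => i Ji.
  have /eqP := esym mu0; rewrite psumr_eq0 // => /allP /(_ i (mem_index_enum i)).
  by rewrite Ji => /eqP ->; rewrite scale0r.
set C := [set mu^-1 *: \sum_(i < n | J i) lambda i *: s i | s in selection].
have oC : open (C : set (weak_ball X)) by exact/p1X/subfamily_convex_combination.
have [s0 s0P] := selection_nonempty.
pose c := mu^-1 *: \sum_(i < n | J i) lambda i *: s0 i.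
have Cc : C c by exists s0.
have c1 : `|c| <= 1.
  rewrite normrZ gtr0_norm ?invr_gt0 // mulrC ler_pdivrMr // mul1r.
  apply: le_trans (ler_norm_sum _ _ _) _; apply: ler_sum => i Ji.
  by rewrite normrZ ger0_norm // ler_piMr //; have [] := s0P _ Ji.
have [a Ca a1] := weakly_open_meets_sphere infX oC Cc c1.
have [|I [F [e [e0 FC]]]] := open_weak_ball_base oC Ca; first by rewrite a1.
have [g gle ga] := norming_dual a.
pose M := \sum_i `|dual_fun (F i) a|.
have M0 : 0 <= M by exact: sumr_ge0.
have FM i : `|dual_fun (F i) a| <= M.
  by rewrite /M (bigD1 i) //= lerDl sumr_ge0.
(* The first bound keeps [p] above [mu / 2]. The second gives [d * (1 + M) <= e * (mu / 2) < e * p],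
   which controls the error of rescaling [u] by the inverse of [p]. *)
pose d := Num.min (mu / 2) (e * (mu / 2) / (1 + M)).
have d0 : 0 < d by rewrite lt_min !divr_gt0 ?mulr_gt0 ?divr_gt0 // ltr_pwDl.
exists a, (option I), (fun k => if k is Some i then F i else g), d; split=> //.
  move=> u r r0 /(_ None); rewrite ga a1 mulr1 ltr_norml => /andP[+ _].
  by have := gle u; rewrite ler_norml => /andP[_]; lra.
move=> u p up pmu Fu.
have p2 : mu / 2 < p.
  by move: pmu; rewrite lt_min ltr_norml => /andP[/andP[+ _] _]; lra.
have p0 : 0 < p by apply: lt_trans p2; rewrite divr_gt0.
have [||s sP sE] := FC (p^-1 *: u).
- move=> i; rewrite dual_funZ.
  set A := dual_fun (F i) a; set U := dual_fun (F i) u.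
  have -> : p^-1 * U - A = p^-1 * ((U - mu * A) - (p - mu) * A).
    by field; rewrite gt_eqF.
  rewrite normrM gtr0_norm ?invr_gt0 // mulrC ltr_pdivrMr //.
  apply: (@le_lt_trans _ _ (d * (1 + M))).
    rewrite mulrDr mulr1; apply: le_trans (ler_normB _ _) _.
    apply: lerD; first by apply: ltW; exact: (Fu (Some i)).
    by rewrite normrM; apply: ler_pM (ltW pmu) (FM i).
  apply: (@le_lt_trans _ _ (e * (mu / 2))); last by rewrite ltr_pM2l.
  by rewrite -ler_pdivlMr ?ltr_pwDl // ge_min lexx orbT.
- by rewrite normrZ gtr0_norm ?invr_gt0 // mulrC ler_pdivrMr // mul1r.
exists s => //; rewrite -scalerA -sE scalerA mulfV ?scale1r // gt_eqF //.
Qed.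

End SubfamilyCombination.

(** * Functionals on the l1-sum *)

Section L1sumDual.
Context {R : realType} {X Y : completeNormedModType R}.
Local Notation Z := (l1sum X Y).

(** The norm of [f] is at most the maximum of the norms of its restrictions to the summands, so
    these cannot both be below 1. *)
Lemma dual_l1sum_split (f : dual Z) : dual_sphere f ->
  exists (g : dual X) (h : dual Y),
  [/\ forall z : Z, dual_fun f z = dual_fun g z.1 + dual_fun h z.2,
      forall x, `|dual_fun g x| <= `|x|, forall y, `|dual_fun h y| <= `|y| &
      dual_sphere g \/ dual_sphere h].
Proof.
move=> f1.
have fle z : `|dual_fun f z| <= `|z|.
  by have := dual_fun_le f z; rewrite f1 mul1r.
pose g0 (x : X) := dual_fun f ((x, 0) : Z).
pose h0 (y : Y) := dual_fun f ((0, y) : Z).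
have g0_linear : linear g0.
  move=> c x x'; rewrite /g0 -[c *: dual_fun f _]dual_funZ -dual_funD; congr (dual_fun f _).
  by apply/pair_equal_spec; split=> //=; rewrite scaler0 addr0.
have h0_linear : linear h0.
  move=> c y y'; rewrite /h0 -[c *: dual_fun f _]dual_funZ -dual_funD; congr (dual_fun f _).
  by apply/pair_equal_spec; split=> //=; rewrite scaler0 addr0.
have gle x : `|g0 x| <= `|x|.
  by apply: le_trans (fle _) _; rewrite l1sum_normE /= normr0 addr0.
have hle y : `|h0 y| <= `|y|.
  by apply: le_trans (fle _) _; rewrite l1sum_normE /= normr0 add0r.
pose gL : {linear X -> R} := HB.pack g0 (GRing.isLinear.Build R X R _ g0 g0_linear).
pose hL : {linear Y -> R} := HB.pack h0 (GRing.isLinear.Build R Y R _ h0 h0_linear).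
have [|g gE] := @bounded_linear_dual R X gL 1; first by move=> x; rewrite mul1r gle.
have [|h hE] := @bounded_linear_dual R Y hL 1; first by move=> y; rewrite mul1r hle.
have fE (z : Z) : dual_fun f z = dual_fun g z.1 + dual_fun h z.2.
  rewrite gE hE /= /g0 /h0 -dual_funD; congr (dual_fun f _).
  by case: z => x y; apply/pair_equal_spec; split=> /=; rewrite ?addr0 ?add0r.
exists g, h; split=> //; [by rewrite gE|by rewrite hE|].
have g1 : dual_norm g <= 1.
  by apply: dual_norm_le => x x1; rewrite gE; exact: le_trans (gle x) x1.
have h1 : dual_norm h <= 1.
  by apply: dual_norm_le => x x1; rewrite hE; exact: le_trans (hle x) x1.
have [?|gn1] := eqVneq (dual_norm g) 1; [by left|right].
apply/eqP; rewrite eq_le h1 leNgt; apply/negP => hn1.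
have c0 : 0 <= Num.max (dual_norm g) (dual_norm h).
  by rewrite le_max dual_norm_ge0.
have : dual_norm f <= Num.max (dual_norm g) (dual_norm h).
  apply: dual_norm_le => z z1; rewrite fE; apply: le_trans (ler_normD _ _) _.
  apply: (@le_trans _ _ (Num.max (dual_norm g) (dual_norm h) * `|z|)).
    rewrite l1sum_normE mulrDr; apply: lerD; apply: le_trans (dual_fun_le _ _) _.
      by rewrite ler_wpM2r // le_max lexx.
    by rewrite ler_wpM2r // le_max lexx orbT.
  by rewrite ler_piMr.
by rewrite f1 leNgt gt_max lt_neqAle gn1 g1 hn1.
Qed.

Lemma dual_l1sum_fst (g : dual X) :
  exists f : dual Z, forall z : Z, dual_fun f z = dual_fun g z.1.
Proof.
pose f0 (z : Z) := dual_fun g z.1.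
have f0_linear : linear f0 by move=> c z t; rewrite /f0 /= dual_funD dual_funZ.
pose fL : {linear Z -> R} := HB.pack f0 (GRing.isLinear.Build R Z R _ f0 f0_linear).
have [|f fE] := @bounded_linear_dual R Z fL `|dual_norm g|; last by exists f; rewrite fE.
move=> z; apply: le_trans (dual_fun_le _ _) _; apply: le_trans (ler_norm _) _.
by rewrite normrM normr_id ler_wpM2l // l1sum_normE lerDl.
Qed.

Lemma dual_l1sum_snd (h : dual Y) :
  exists f : dual Z, forall z : Z, dual_fun f z = dual_fun h z.2.
Proof.
pose f0 (z : Z) := dual_fun h z.2.
have f0_linear : linear f0 by move=> c z t; rewrite /f0 /= dual_funD dual_funZ.
pose fL : {linear Z -> R} := HB.pack f0 (GRing.isLinear.Build R Z R _ f0 f0_linear).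
have [|f fE] := @bounded_linear_dual R Z fL `|dual_norm h|; last by exists f; rewrite fE.
move=> z; apply: le_trans (dual_fun_le _ _) _; apply: le_trans (ler_norm _) _.
by rewrite normrM normr_id ler_wpM2l // l1sum_normE lerDr.
Qed.

End L1sumDual.

(** * Balancing the mass between the two groups *)

Section Redistribution.
Context {R : realType} {X Y : completeNormedModType R}.

(* The mass [p - mu] that [u] has in excess is spread over the indices outside
   [J], whose slices tolerate a small [X]-component. *)
Lemma redistribute (n : nat) (lambda : 'I_n -> R) (J : pred 'I_n)
    (f : 'I_n -> dual X) (g : 'I_n -> dual Y) (alpha : 'I_n -> R)
    (s : 'I_n -> X) (t : 'I_n -> Y) (u : X) (v : Y) (p q : R) :
  let mu := \sum_(i < n | J i) lambda i in
  let nu := \sum_(i < n | ~~ J i) lambda i in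
  (forall i, 0 <= lambda i) -> mu + nu = 1 -> p + q = 1 ->
  `|u| <= p -> `|v| <= q -> mu <= p ->
  (forall i, 0 < alpha i) -> (forall i, 0 < nu -> p - mu <= nu * (alpha i / 8)) ->
  (forall i x, `|dual_fun (f i) x| <= `|x|) ->
  (forall i, J i -> slice (f i) (alpha i / 2) (s i)) ->
  (forall i, ~~ J i -> slice (g i) (alpha i / 2) (t i)) ->
  \sum_(i < n | J i) lambda i *: s i = (mu / p) *: u ->
  \sum_(i < n | ~~ J i) lambda i *: t i = (nu / q) *: v ->
  exists (w : 'I_n -> X) (y : 'I_n -> Y),
  [/\ forall i, `|w i| + `|y i| <= 1,
      forall i, 1 - alpha i < dual_fun (f i) (w i) + dual_fun (g i) (y i),
      \sum_(i < n) lambda i *: w i = u & \sum_(i < n) lambda i *: y i = v].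
Proof.
move=> mu nu lambda0 munu pq up vq mup alpha0 small f1 sS tS sE tE.
have p0 : 0 <= p by exact: le_trans up.
have q0 : 0 <= q by exact: le_trans vq.
have mu0 : 0 <= mu by exact: sumr_ge0.
have nu0 : 0 <= nu by exact: sumr_ge0.
(* Each index outside [J] gives up the fraction [k] of its [Y]-part for an [X]-component of norm at
   most [k]. If [nu = 0], then [mu = 1] forces [p = mu], which agrees with the default value
   [k = 0]. *)
pose k := (p - mu) / nu.
have knu : nu * k = p - mu.
  have [nuE|nun0] := eqVneq nu 0; last by rewrite mulrC divfK.
  by rewrite nuE mul0r; lra.
have k0 : 0 <= k by rewrite divr_ge0 // subr_ge0.
have k1 : k <= 1.
  have [nuE|nun0] := eqVneq nu 0; first by rewrite /k nuE invr0 mulr0.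
  by rewrite ler_pdivrMr ?lt_def ?nun0 //; lra.
have ka i : k <= alpha i / 8.
  have [nuE|nun0] := eqVneq nu 0.
    by rewrite /k nuE invr0 mulr0 divr_ge0 // ltW.
  have nugt0 : 0 < nu by rewrite lt_def nun0.
  by rewrite ler_pdivrMr // mulrC small.
have up1 : `|(k / p) *: u| <= k.
  rewrite normrZ normrM (ger0_norm k0) normfV (ger0_norm p0) -mulrA ler_piMr //.
  have [->|pn0] := eqVneq p 0; first by rewrite invr0 mul0r.
  by rewrite mulrC ler_pdivrMr ?mul1r // lt_def pn0.
exists (fun i => if J i then s i else (k / p) *: u),
  (fun i => if J i then 0 else (1 - k) *: t i); split.
- move=> i; case: ifP => [Ji|/negbT nJi].
    by rewrite normr0 addr0; case: (sS i Ji).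
  rewrite [X in _ + X]normrZ (ger0_norm (_ : 0 <= 1 - k)) ?subr_ge0 //.
  have [ti1 _] := tS i nJi.
  have : (1 - k) * `|t i| <= 1 - k by rewrite ler_piMr // subr_ge0.
  by move: up1; lra.
- move=> i; case: ifP => [Ji|/negbT nJi].
    have [_] := sS i Ji; rewrite [dual_fun (g i) 0]linear0 addr0.
    by have := alpha0 i; lra.
  have [_ ti2] := tS i nJi; rewrite [dual_fun (g i) _]dual_funZ.
  (* Depth budget: the half slice costs [alpha i / 2]; shrinking the [Y]-part and the new
     [X]-component cost at most [k <= alpha i / 8] each. *)
  have := le_trans (f1 i _) up1; rewrite ler_norml => /andP[+ _].
  have := ka i; have := alpha0 i.
  have : (1 - k) * (1 - alpha i / 2) <= (1 - k) * dual_fun (g i) (t i).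
    by rewrite ler_wpM2l ?subr_ge0 // ltW.
  by have := mulr_ge0 k0 (ltW (alpha0 i)); lra.
- rewrite (bigID J) /=.
  under eq_bigr => i Ji do rewrite Ji.
  rewrite sE; under eq_bigr => i nJi do rewrite (negbTE nJi).
  rewrite -scaler_suml -/nu scalerA -scalerDl mulrA knu -mulrDl addrC subrK.
  (* The coefficient of [u] is now [p / p]. For [p = 0] it is 0 by convention, but then [u] is zero
     as well. *)
  have [pE|pn0] := eqVneq p 0; last by rewrite mulfV // scale1r.
  by rewrite pE mul0r scale0r; apply/esym/eqP; rewrite -normr_le0 -pE.
- rewrite (bigID J) /= big1 ?add0r; last by move=> i ->; rewrite scaler0.
  under eq_bigr => i nJi do rewrite (negbTE nJi) scalerA mulrC -scalerA.
  rewrite -scaler_sumr tE scalerA mulrA mulrBl mul1r mulrC (mulrC k) knu.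
  have -> : nu - (p - mu) = q by lra.
  have [qE|qn0] := eqVneq q 0; last by rewrite mulVf // scale1r.
  by rewrite qE mulr0 scale0r; apply/esym/eqP; rewrite -normr_le0 -qE.
Qed.

(** If neither [a] exceeds [mu] nor [b] exceeds [nu], the pair [mu], [nu] works. Otherwise the
    exceeding number is kept and the other share is its complement; [a + b <= 1] and the lower
    bounds limit the excess to less than [e]. *)
Lemma split_unit_mass (mu nu a b e : R) : 0 < e -> mu + nu = 1 -> a + b <= 1 ->
  mu - e < a -> nu - e < b ->
  exists p q, [/\ p + q = 1, a <= p, b <= q, `|p - mu| < e & `|q - nu| < e].
Proof.
move=> e0 munu ab mua nub.
have [amu|mu_a] := leP a mu; last first.
  by exists a, (1 - a); rewrite !ltr_norml; split; rewrite ?lexx //; lra.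
have [bnu|nu_b] := leP b nu.
  by exists mu, nu; rewrite !subrr normr0.
by exists (1 - b), b; rewrite !ltr_norml; split; rewrite ?lexx //; lra.
Qed.

End Redistribution.

(** * Assembling the neighbourhood in the l1-sum *)

Lemma common_lower_bound (R : realType) (n : nat) (c : 'I_n -> R) :
  (forall i, 0 < c i) -> exists2 m, 0 < m & forall i, m <= c i.
Proof.
move=> c0; exists (\big[Num.min/1]_(i < n) c i).
  by elim/big_ind: _ => // x y x0 y0; rewrite lt_min x0.
by move=> i; rewrite (bigD1 i) //= ge_min lexx.
Qed.

Theorem proposition2p4 (R : realType) (X Y : completeNormedModType R)
    (hX : infinite_dimensional X) (hY : infinite_dimensional Y)
    (p1X : P1 X) (p1Y : P1 Y) :
  P2 (l1sum X Y).
Proof.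
move=> C [n [lambda [S [lambda0 lambda1 Sslice ->]]]].
have /choice[fa faP] : forall i, exists fa : dual (l1sum X Y) * R,
    [/\ dual_sphere fa.1, 0 < fa.2 & S i = slice fa.1 fa.2].
  by move=> i; have [f [alpha [? ? ?]]] := Sslice i; exists (f, alpha).
have /choice[gh ghP] : forall i, exists gh : dual X * dual Y,
    [/\ forall z : l1sum X Y,
          dual_fun (fa i).1 z = dual_fun gh.1 z.1 + dual_fun gh.2 z.2,
        forall x, `|dual_fun gh.1 x| <= `|x|,
        forall y, `|dual_fun gh.2 y| <= `|y| &
        dual_sphere gh.1 \/ dual_sphere gh.2].
  move=> i; have [f1 _ _] := faP i.
  by have [g [h [? ? ? ?]]] := dual_l1sum_split f1; exists (g, h).
pose alpha i := (fa i).2; pose g i := (gh i).1; pose h i := (gh i).2.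
have alpha0 i : 0 < alpha i by case: (faP i).
have alpha20 i : 0 < alpha i / 2 by rewrite divr_gt0.
have gle i x : `|dual_fun (g i) x| <= `|x| by case: (ghP i).
have hle i y : `|dual_fun (h i) y| <= `|y| by case: (ghP i).
(* Indices for which both restrictions have norm one go to the [X]-group. *)
pose J : pred 'I_n := fun i => `[< dual_sphere (g i) >].
pose Jc : pred 'I_n := fun i => ~~ J i.
have gJ i : J i -> dual_sphere (g i) by move/asboolP.
have hJ i : Jc i -> dual_sphere (h i).
  by move/asboolPn => ng; have [_ _ _ []] := ghP i.
pose mu := \sum_(i < n | J i) lambda i.
pose nu := \sum_(i < n | Jc i) lambda i.
have munu : mu + nu = 1 by rewrite -lambda1 (bigID J).
have mu0 : 0 <= mu by exact: sumr_ge0.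
have nu0 : 0 <= nu by exact: sumr_ge0.
have [a [I [F [dX [a1 dX0 Xlow Xsel]]]]] :=
  selection_near_sphere lambda0 gJ alpha20 hX p1X.
have [b [K [G [dY [b1 dY0 Ylow Ysel]]]]] :=
  selection_near_sphere lambda0 hJ alpha20 hY p1Y.
have [m m0 malpha] : exists2 m, 0 < m & forall i, m <= alpha i / 8.
  by apply: common_lower_bound => i; rewrite divr_gt0.
(* A group of weight zero carries no surplus; replacing its weight by 1 keeps [e] positive. *)
pose pos (r : R) := if 0 < r then r else 1.
have pos_gt0 r : 0 < pos r by rewrite /pos; case: ifP.
(* The bounds [dX] and [dY] serve the two selections; the other two limit the surplus of either
   group to what the slices of the opposite group tolerate. *)
pose e := Num.min (Num.min dX dY) (Num.min (pos mu * m) (pos nu * m)).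
have e0 : 0 < e by rewrite !lt_min dX0 dY0 !mulr_gt0.
have [edX edY emu enu] :
    [/\ e <= dX, e <= dY, e <= pos mu * m & e <= pos nu * m].
  by split; rewrite /e !ge_min lexx ?orbT.
have small r i : 0 < r -> e <= pos r * m -> e <= r * (alpha i / 8).
  move=> r0; rewrite /pos r0 => /le_trans; apply; by rewrite ler_wpM2l // ltW.
have /choice[F' F'E] := fun k => dual_l1sum_fst (Y := Y) (F k).
have /choice[G' G'E] := fun k => dual_l1sum_snd (X := X) (G k).
pose z0 : l1sum X Y := (mu *: a, nu *: b).
have z01 : `|z0| <= 1.
  by rewrite l1sum_normE /= !normrZ a1 b1 !mulr1 !ger0_norm // munu.
exists z0; apply: weak_ball_interior_base => //.
exists (I + K)%type, (fun k => match k with inl i => F' i | inr j => G' j end), e.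
split=> // -[u v] near_z0 /=; rewrite l1sum_normE /= => uv1.
have near_u k : `|dual_fun (F k) u - mu * dual_fun (F k) a| < e.
  by have := near_z0 (inl k); rewrite /= !F'E /= dual_funZ.
have near_v k : `|dual_fun (G k) v - nu * dual_fun (G k) b| < e.
  by have := near_z0 (inr k); rewrite /= !G'E /= dual_funZ.
have [p [q [pq up vq pmu qnu]]] := split_unit_mass e0 munu uv1
  (Xlow u e e0 near_u) (Ylow v e e0 near_v).
have [s sS sE] := Xsel u p up (lt_le_trans pmu edX)
  (fun k => lt_le_trans (near_u k) edX).
have [t tS tE] := Ysel v q vq (lt_le_trans qnu edY)
  (fun k => lt_le_trans (near_v k) edY).
have [w [y [wy1 wyS wE yE]]] : exists (w : 'I_n -> X) (y : 'I_n -> Y),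
  [/\ forall i, `|w i| + `|y i| <= 1,
      forall i, 1 - alpha i < dual_fun (g i) (w i) + dual_fun (h i) (y i),
      \sum_(i < n) lambda i *: w i = u & \sum_(i < n) lambda i *: y i = v].
  have [mup|pmu'] := leP mu p.
    apply: (redistribute lambda0 munu pq up vq mup alpha0 _ gle sS tS sE tE).
    move=> i nugt0; apply: le_trans (small _ i nugt0 enu).
    by apply: le_trans (ltW pmu); exact: ler_norm.
  have nuq : nu <= q by lra.
  have JcC : \sum_(i < n | ~~ Jc i) lambda i = mu.
    by apply: eq_bigl => i; rewrite /Jc negbK.
  (* Here [q >= nu], so the [Y]-group has the surplus and the roles of [X] and [Y] are exchanged;
     the complement of [Jc] is [J] up to a double negation. *)
  have [|||||y [w [wy1 wyS yE wE]]] := @redistribute R Y X n lambda Jc h g alpha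
      t s v u q p lambda0 _ _ vq up nuq alpha0 _ hle tS _ tE.
  - by rewrite JcC addrC.
  - by rewrite addrC.
  - move=> i; rewrite JcC => mugt0; apply: le_trans (small _ i mugt0 emu).
    by apply: le_trans (ltW qnu); exact: ler_norm.
  - by move=> i; rewrite negbK => /sS.
  - by rewrite JcC -sE; apply: eq_bigl => i; rewrite /Jc negbK.
  exists w, y; split=> // i; first by rewrite addrC.
  by rewrite [dual_fun _ _ + _]addrC.
exists (fun i => (w i, y i) : l1sum X Y).
  move=> i; have [_ _ ->] := faP i; split; first exact: wy1.
  by have [-> _ _ _] := ghP i; exact: wyS.
have sum1 (r : 'I_n -> l1sum X Y) : (\sum_i r i).1 = \sum_i (r i).1.
  by apply: (big_morph (fun z : l1sum X Y => z.1)).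
have sum2 (r : 'I_n -> l1sum X Y) : (\sum_i r i).2 = \sum_i (r i).2.
  by apply: (big_morph (fun z : l1sum X Y => z.2)).
by rewrite [LHS]surjective_pairing sum1 sum2 -wE -yE.
Qed.
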